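(* Let $R>0$ and $\alpha>0$. For every $t\in\mathbb{R}^+$ and $q\in\mathbb{B}_R$, $$A^{\alpha}_{R,slice}(t;q)=\left(1-\frac{q}{R}\right)^{-\alpha-1}\exp\left(\frac{tq}{q-R}\right).$$
   Context: $\mathbb{H}$ is the algebra of quaternions with modulus $|q|$; $\mathbb{S}=\{I\in\mathbb{H}: I^2=-1\}$; for $J\in\mathbb{S}$, $\mathbb{C}_J=\mathbb{R}+\mathbb{R}J$. $\mathbb{B}_R=\{q\in\mathbb{H}:|q|<R\}$ and $\mathbb{B}_{R,J}=\mathbb{B}_R\cap\mathbb{C}_J$. The function $A^{\alpha}_{R,slice}$ on $\mathbb{R}^+\times\mathbb{B}_R$ is defined, for $q=x+yI_q$ with $x,y\in\mathbb{R}$, $I_q\in\mathbb{S}$, and $J\in\mathbb{S}$ an arbitrarily fixed imaginary unit, by $$A^{\alpha}_{R,slice}(t;x+yI_q)=\frac{1-I_qJ}{2}A^{\alpha}_{R,hol}(t;x+yJ)+\frac{1+I_qJ}{2}A^{\alpha}_{R,hol}(t;x-yJ),$$ where, for $z\in\mathbb{B}_{R,J}$, $A^{\alpha}_{R,hol}(t;z)=\exp\left(\frac{tz}{z-R}\right)\left(1-\frac{z}{R}\right)^{-\alpha-1}$ is computed in the complex plane $\mathbb{C}_J$. Powers are principal, and the expression in $q$ on the right-hand side of the claim is computed in a slice $\mathbb{C}_{I_q}$ containing $q$. *)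

(* Defs.v *)
From HB Require Import structures.
From mathcomp Require Import all_boot all_order all_algebra.
From mathcomp Require Import all_classical all_reals all_analysis.
From mathcomp Require Import ring lra.

Set Implicit Arguments.
Unset Strict Implicit.
Unset Printing Implicit Defensive.
Import Order.TTheory GRing.Theory Num.Theory.
From mathcomp Require Import complex.
Local Open Scope ring_scope.
Local Open Scope complex_scope.
Local Notation normc := ComplexField.Normc.normc.

Section ComplexFunctions.
Context {K : realType}.
Implicit Types (z w : K[i]) (s : K).

Definition cexp z : K[i] := (expR (Re z))%:C * (cos (Im z) +i* sin (Im z)).

(* Values are in ]-pi, pi] (see [carg_itv]); junk value at 0. *)
Definition carg z : K :=
  if 0 <= Im z then acos (Re z / normc z) else - acos (Re z / normc z).

Definition clog z : K[i] := ln (normc z) +i* carg z.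

(* Junk value at 0. *)
Definition cpowr z s : K[i] := cexp (s%:C * clog z).

Lemma normc_gt0 z : z != 0 -> 0 < normc z.
Proof.
case: z => a b; rewrite eq_complex /= negb_and => h.
rewrite sqrtr_gt0 /= lt0r addr_ge0 ?sqr_ge0 // andbT.
by rewrite paddr_eq0 ?sqr_ge0 // !sqrf_eq0 negb_and.
Qed.

Lemma sqr_normc z : normc z ^+ 2 = Re z ^+ 2 + Im z ^+ 2.
Proof. by case: z => a b; rewrite sqr_sqrtr // addr_ge0 ?sqr_ge0. Qed.

Lemma normc_Re_itv z : -1 <= Re z / normc z <= 1.
Proof.
have [->|/normc_gt0 h] := eqVneq z 0.
  by rewrite /= mul0r oppr_le0 ler01.
rewrite ler_pdivlMr // ler_pdivrMr // mulN1r mul1r -ler_norml.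
case: z {h} => a b /=; rewrite -sqrtr_sqr ler_sqrt ?lerDl ?sqr_ge0 //.
by rewrite addr_ge0 ?sqr_ge0.
Qed.

Lemma carg_itv z : - pi < carg z <= pi.
Proof.
have h := normc_Re_itv z; rewrite /carg; case: ifPn => [_|].
  rewrite acos_lepi // andbT (lt_le_trans _ (acos_ge0 h)) //.
  by rewrite oppr_lt0 pi_gt0.
rewrite -ltNge => Iz; rewrite ltrN2.
rewrite (le_trans _ (pi_ge0 K)) ?oppr_le0 ?acos_ge0 // andbT.
apply: acos_ltpi; move: (h) => /andP[_ ->]; rewrite andbT.
have hz : 0 < normc z.
  by apply: normc_gt0; apply/eqP => z0; move: Iz; rewrite z0 /= ltxx.
rewrite ltr_pdivlMr // mulN1r.
have := sqr_normc z; nra.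
Qed.

Lemma clogK z : z != 0 -> cexp (clog z) = z.
Proof.
move=> z0; have hz := normc_gt0 z0; have h := normc_Re_itv z.
have hs : normc z * Num.sqrt (1 - (Re z / normc z) ^+ 2) = `|Im z|.
  rewrite -{1}(ger0_norm (ltW hz)) -sqrtr_sqr -sqrtrM ?sqr_ge0 //.
  rewrite mulrBr mulr1 -exprMn mulrCA divff ?gt_eqF // mulr1 sqr_normc.
  by rewrite addrAC subrr add0r sqrtr_sqr.
have hc : normc z * (Re z / normc z) = Re z by rewrite mulrC divfK ?gt_eqF.
rewrite /cexp /clog /= lnK ?posrE //.
apply/eqP; rewrite eq_complex /= !mul0r subr0 addr0 /carg.
case: ifPn => Iz; rewrite ?addr0 ?cosN ?sinN acosK ?in_itv //= sin_acos //.
  by rewrite hc hs ger0_norm // !eqxx.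
rewrite -ltNge in Iz.
by rewrite hc mulrN hs ltr0_norm // opprK !eqxx.
Qed.

End ComplexFunctions.

Record quat (K : Type) : Type := Quat { qa : K; qb : K; qc : K; qd : K }.

Section QuatChoice.
Variable K : Type.
Definition seq_of_quat (q : quat K) := let: Quat a b c d := q in [:: a; b; c; d].
Definition quat_of_seq (s : seq K) :=
  if s is [:: a; b; c; d] then Some (Quat a b c d) else None.
Lemma seq_of_quatK : pcancel seq_of_quat quat_of_seq. Proof. by case. Qed.
End QuatChoice.

HB.instance Definition _ (K : eqType) := Equality.copy (quat K)
  (pcan_type (@seq_of_quatK K)).
HB.instance Definition _ (K : choiceType) := Choice.copy (quat K)
  (pcan_type (@seq_of_quatK K)).

Section QuatAlgebra.
Variable K : comNzRingType.
Implicit Types (p q : quat K) (k : K).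

Definition addq p q :=
  Quat (qa p + qa q) (qb p + qb q) (qc p + qc q) (qd p + qd q).
Definition oppq p := Quat (- qa p) (- qb p) (- qc p) (- qd p).
Definition mulq p q :=
  Quat (qa p * qa q - qb p * qb q - qc p * qc q - qd p * qd q)
       (qa p * qb q + qb p * qa q + qc p * qd q - qd p * qc q)
       (qa p * qc q - qb p * qd q + qc p * qa q + qd p * qb q)
       (qa p * qd q + qb p * qc q - qc p * qb q + qd p * qa q).
Definition scaleq k q := Quat (k * qa q) (k * qb q) (k * qc q) (k * qd q).

Local Ltac quat_ring :=
  intros; rewrite /mulq /addq /oppq /scaleq /=;
  congr Quat => /=; ring.

Fact addqA : associative addq.
Proof. move=> ? ? ?; quat_ring. Qed.
Fact addqC : commutative addq.
Proof. move=> ? ?; quat_ring. Qed.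
Fact add0q : left_id (Quat 0 0 0 0) addq.
Proof. case=> ? ? ? ?; quat_ring. Qed.
Fact addNq : left_inverse (Quat 0 0 0 0) oppq addq.
Proof. move=> ?; quat_ring. Qed.
HB.instance Definition _ :=
  GRing.isZmodule.Build (quat K) addqA addqC add0q addNq.

Fact mulqA : associative mulq.
Proof. move=> ? ? ?; quat_ring. Qed.
Fact mul1q : left_id (Quat 1 0 0 0) mulq.
Proof. case=> ? ? ? ?; quat_ring. Qed.
Fact mulq1 : right_id (Quat 1 0 0 0) mulq.
Proof. case=> ? ? ? ?; quat_ring. Qed.
Fact mulqDl : left_distributive mulq addq.
Proof. move=> ? ? ?; quat_ring. Qed.
Fact mulqDr : right_distributive mulq addq.
Proof. move=> ? ? ?; quat_ring. Qed.
Fact oneq_neq0 : Quat 1 0 0 0 != Quat 0 0 0 0 :> quat K.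
Proof. by apply/eqP => -[/eqP]; rewrite oner_eq0. Qed.
HB.instance Definition _ := GRing.Zmodule_isNzRing.Build (quat K)
  mulqA mul1q mulq1 mulqDl mulqDr oneq_neq0.

Fact scaleqA a b q : scaleq a (scaleq b q) = scaleq (a * b) q.
Proof. quat_ring. Qed.
Fact scale1q : left_id 1 scaleq.
Proof. case=> ? ? ? ?; quat_ring. Qed.
Fact scaleqDr : right_distributive scaleq addq.
Proof. move=> ? ? ?; quat_ring. Qed.
Fact scaleqDl q a b : scaleq (a + b) q = addq (scaleq a q) (scaleq b q).
Proof. quat_ring. Qed.
HB.instance Definition _ := GRing.Zmodule_isLmodule.Build K (quat K)
  scaleqA scale1q scaleqDr scaleqDl.
Fact scaleqAl k p q : scaleq k (mulq p q) = mulq (scaleq k p) q.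
Proof. quat_ring. Qed.
HB.instance Definition _ :=
  GRing.Lmodule_isLalgebra.Build K (quat K) scaleqAl.
Fact scaleqAr k p q : scaleq k (mulq p q) = mulq p (scaleq k q).
Proof. quat_ring. Qed.
HB.instance Definition _ :=
  GRing.Lalgebra_isAlgebra.Build K (quat K) scaleqAr.

End QuatAlgebra.

Section SliceFunctions.
Context {K : realType}.
Implicit Types (p q I J : quat K) (z : K[i]).

Definition qabs q : K :=
  Num.sqrt (qa q ^+ 2 + qb q ^+ 2 + qc q ^+ 2 + qd q ^+ 2).

Definition qball (R : K) : set (quat K) := [set q | qabs q < R].

Definition imunit : set (quat K) := [set I | I * I = -1].

(* The isomorphism from the complex numbers onto the slice C_I; a function of
   a complex variable is computed in C_I by transport along it. *)
Definition in_slice I z : quat K := (Re z)%:A + Im z *: I.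

Definition vecpart q : quat K := Quat 0 (qb q) (qc q) (qd q).

(* The choice between I and -I, and of an imaginary unit at real quaternions,
   is immaterial for [A_slice]: see [A_sliceE]. *)
Definition imdir q : quat K :=
  if vecpart q == 0 then Quat 0 1 0 0 else (qabs (vecpart q))^-1 *: vecpart q.

Definition A_hol (R alpha t : K) z : K[i] :=
  cexp (t%:C * z / (z - R%:C)) * cpowr (1 - z / R%:C) (- alpha - 1).

Definition A_slice_at J (R alpha t x y : K) I : quat K :=
  2^-1 *: (1 - I * J) * in_slice J (A_hol R alpha t (x +i* y)) +
  2^-1 *: (1 + I * J) * in_slice J (A_hol R alpha t (x -i* y)).

Definition A_slice J (R alpha t : K) q : quat K :=
  A_slice_at J R alpha t (qa q) (qabs (vecpart q)) (imdir q).

Lemma imunitP I :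
  imunit I <-> qa I = 0 /\ qb I ^+ 2 + qc I ^+ 2 + qd I ^+ 2 = 1.
Proof.
case: I => a b c d; rewrite /imunit /=; split=> [[]|[-> h]]; last first.
  by congr Quat => /=; [lra|ring..].
rewrite oppr0 => h1 h2 h3 h4.
have a0 : a = 0 by apply/eqP/negPn/negP => /eqP; nra.
by split=> //; move: h1; rewrite a0; lra.
Qed.

Lemma imunit_imdir q : imunit (imdir q).
Proof.
apply/imunitP; rewrite /imdir; case: eqVneq => [_|q0] /=.
  by split=> //; rewrite expr1n expr0n !addr0.
split; first by rewrite mulr0.
set n := qabs _.
have n2 : n ^+ 2 = qb q ^+ 2 + qc q ^+ 2 + qd q ^+ 2.
  by rewrite sqr_sqrtr /= ?expr0n ?add0r // !addr_ge0 ?sqr_ge0.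
rewrite !exprMn -!mulrDr -n2 exprVn mulVf // n2.
apply: contra q0; rewrite !paddr_eq0 ?addr_ge0 ?sqr_ge0 // !sqrf_eq0.
by move=> /andP[/andP[/eqP h1 /eqP h2] /eqP h3]; rewrite /vecpart h1 h2 h3.
Qed.

Lemma in_slice_imdir q :
  q = in_slice (imdir q) (qa q +i* qabs (vecpart q)).
Proof.
rewrite /in_slice /imdir; case: eqVneq => [q0|q0] /=.
  rewrite q0; case: q q0 => a b c d [-> -> ->].
  have -> : qabs (0 : quat K) = 0 by rewrite /qabs /= expr0n !addr0 sqrtr0.
  by congr Quat => /=; ring.
rewrite scalerA divff ?scale1r.
  by case: q q0 => a b c d _; congr Quat => /=; ring.
apply: contra q0; rewrite /qabs sqrtr_eq0 /= expr0n add0r => h.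
have {}h : qb q ^+ 2 + qc q ^+ 2 + qd q ^+ 2 == 0.
  by rewrite eq_le h !addr_ge0 ?sqr_ge0.
move: h; rewrite !paddr_eq0 ?addr_ge0 ?sqr_ge0 // !sqrf_eq0.
by move=> /andP[/andP[/eqP h1 /eqP h2] /eqP h3]; rewrite /vecpart h1 h2 h3.
Qed.

Lemma A_sliceE J (R alpha t x y : K) I : imunit I ->
  A_slice J R alpha t (in_slice I (x +i* y)) =
  A_slice_at J R alpha t x y I.
Proof.
move=> /imunitP[Ia In]; set q := in_slice _ _.
have qx : qa q = x by rewrite /q /= Ia; ring.
have qv : vecpart q = y *: I.
  rewrite /vecpart /q /=; case: I Ia {In q qx} => a b c d /= ->.
  by congr Quat => /=; ring.
have qy : qabs (vecpart q) = `|y|.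
  rewrite qv /qabs /= Ia -sqrtr_sqr; congr Num.sqrt.
  by rewrite -[y ^+ 2]mulr1 -In; ring.
rewrite /A_slice qx qy /imdir qy qv scaler_eq0.
have I0 : (I == 0) = false.
  apply/eqP => I0; move: In; rewrite I0 /= !expr0n !addr0 => /esym/eqP.
  by rewrite oner_eq0.
rewrite I0 orbF; case: (ltrgt0P y) => y0.
- by rewrite scalerA mulVf ?scale1r // gt_eqF.
- rewrite scalerA invrN mulNr mulVf ?lt_eqF // scaleN1r /A_slice_at.
  by rewrite mulNr !opprK addrC.
- rewrite y0 /A_slice_at oppr0 -!mulrDl -!scalerDr.
  have e p : 1 - p + (1 + p) = 2 :> quat K by rewrite addrACA addNr addr0.
  by rewrite !e.
Qed.

End SliceFunctions.

(* Main.v *)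
Require Import Defs.
From mathcomp Require Import all_boot all_order all_algebra.
From mathcomp Require Import all_classical all_reals all_analysis.
Import Order.TTheory GRing.Theory Num.Theory.
From mathcomp Require Import complex.
Local Open Scope ring_scope.
Local Open Scope complex_scope.

(** The function [A_hol] is built from the real parameters t, R, alpha by
    arithmetic, the exponential and a principal power, so it commutes with
    complex conjugation as long as the base 1 - z / R of the power stays off
    the branch cut of the logarithm.  This is where the ball enters: |z| < R
    forces Re (1 - z / R) > 0, and on the open right half-plane the principal
    argument is odd under conjugation ([carg_conjc]).  Hence [A_hol] takes at
    x - iy the conjugate of its value a + ib at x + iy ([A_hol_conjc]), and the
    two terms that define the slice function add up to

      (1 - IJ)/2 (a + bJ) + (1 + IJ)/2 (a - bJ) = a - IJJ b = a + bI,

    which is the same complex number a + ib read in the slice of I instead of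
    that of J ([slice_extension_conjc]).  The claimed formula is this value,
    with its two commuting complex factors exchanged.  By [A_sliceE] the
    defining combination may be taken along whichever I and z represent q, so
    the argument also covers real q and both orientations of the slice. *)

Section ConjugationSymmetry.
Context {K : realType}.
Implicit Types (z w : K[i]) (s R alpha t : K).

Lemma cexp_conjc z : cexp z^* = (cexp z)^*.
Proof.
case: z => a b; rewrite /cexp /= cosN sinN.
by apply/eqP; rewrite eq_complex /= !mul0r !subr0 !addr0 mulrN !eqxx.
Qed.

(** The hypothesis keeps z away from the negative real axis, where the
    argument is pi at both z and its conjugate, and from the junk value at 0.
    On the positive real axis the argument vanishes, so oddness persists there
    although both conjugates fall in the same branch of the definition. *)
Lemma carg_conjc z : 0 < Re z -> carg z^* = - carg z.
Proof.
case: z => a b /= a0; rewrite /carg /= sqrrN oppr_ge0.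
case: (ltrgt0P b) => b0; rewrite ?opprK //.
rewrite b0 expr0n addr0 sqrtr_sqr gtr0_norm // divff ?gt_eqF //.
by rewrite acos1 oppr0.
Qed.

Lemma cpowr_conjc z s : 0 < Re z -> cpowr z^* s = (cpowr z s)^*.
Proof.
move=> z0; rewrite /cpowr -cexp_conjc; congr cexp.
rewrite /clog (carg_conjc _ z0); case: z z0 => a b /= _; rewrite sqrrN.
by apply/eqP; rewrite eq_complex /= !mul0r !subr0 !addr0 mulrN !eqxx.
Qed.

Lemma Re_one_sub_div_gt0 R z : 0 < R -> Re z < R -> 0 < Re (1 - z / R%:C).
Proof.
move=> R0; rewrite -fmorphV; case: z => a b /= aR.
rewrite mulr0 subr0 subr_gt0.
by rewrite ltr_pdivrMr // mul1r.
Qed.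

Lemma A_hol_conjc R alpha t z : 0 < R -> Re z < R ->
  A_hol R alpha t z^* = (A_hol R alpha t z)^*.
Proof.
move=> R0 zR.
have conjM u v : (u * v)^*%C = u^*%C * v^*%C :> K[i] by exact: rmorphM.
have conjB u v : (u - v)^*%C = u^*%C - v^*%C :> K[i] by exact: rmorphB.
rewrite /A_hol conjM -cexp_conjc -cpowr_conjc ?Re_one_sub_div_gt0 //.
by rewrite !(conjM, conjB, conjc_inv, conjc1, conjc_real).
Qed.

End ConjugationSymmetry.

Section SliceExtension.
Context {K : realType}.
Implicit Types (I J : quat K) (w z : K[i]).

(** The terms without IJ add up to Re w and those with IJ to - IJ (Im w J),
    which is Im w I because J * J = -1.  Thus extending from any slice a
    function that commutes with conjugation gives the same value at I. *)
Lemma slice_extension_conjc I J w : imunit J ->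
  2^-1 *: (1 - I * J) * in_slice J w +
  2^-1 *: (1 + I * J) * in_slice J w^* = in_slice I w.
Proof.
rewrite /imunit /= => JJ; case: w => a b.
rewrite /in_slice /= -!scalerAl -scalerDr.
set A := a%:A + b *: J; set B := a%:A + - b *: J.
have -> : (1 - I * J) * A + (1 + I * J) * B = (A + B) - I * (J * (A - B)).
  by rewrite !mulrDl !mul1r mulNr addrACA mulrA mulrBr opprB [- _ + _]addrC.
have -> : A + B = 2 *: a%:A.
  by rewrite /A /B scaleNr addrACA subrr addr0 scaler_nat mulr2n.
have -> : A - B = 2 *: (b *: J).
  by rewrite /A /B scaleNr opprD opprK addrACA subrr add0r scaler_nat mulr2n.
rewrite -!scalerAr JJ mulrN1 !scalerN opprK -scalerDr scalerA.
by rewrite mulVf ?pnatr_eq0 // scale1r.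
Qed.

(** An imaginary unit is purely vectorial, so Re z is the real component of the
    quaternion, bounded by its modulus. *)
Lemma qball_in_slice_Re R I z :
  imunit I -> qball R (in_slice I z) -> Re z < R.
Proof.
move=> /imunitP[Ia _]; apply: le_lt_trans.
have {1}-> : Re z = qa (in_slice I z) by rewrite /= Ia mulr0 addr0 mulr1.
set q := in_slice I z; rewrite (le_trans (ler_norm _)) // -sqrtr_sqr.
by rewrite /qabs ler_wsqrtr // -!addrA lerDl !addr_ge0 ?sqr_ge0.
Qed.

End SliceExtension.

Theorem theorem3p11 (K : realType) (R alpha t : K) (J q : quat K) :
  0 < R -> 0 < alpha -> 0 <= t -> imunit J -> qball R q ->
  forall (I : quat K) (z : K[i]), imunit I -> q = in_slice I z ->
    A_slice J R alpha t q =
    in_slice I (cpowr (1 - z / R%:C) (- alpha - 1) *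
                cexp (t%:C * z / (z - R%:C))).
Proof.
move=> R0 _ _ JJ qR I z II qE; rewrite qE in qR *.
have zR := qball_in_slice_Re R I z II qR.
case: z zR {qR qE} => x y zR; rewrite A_sliceE // /A_slice_at.
by rewrite (A_hol_conjc R alpha t (x +i* y)) // slice_extension_conjc // mulrC.
Qed.
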